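(* Let $A>0$, $A'>0$, $s>0$. Then there is $c>0$ such that for any $n\geq 1$, any independent sequence $X_1,\dots,X_n$ of real random variables with $$E(X_i)=0,\quad E(X_i^4)\leq A,\quad E(X_i\mathbf{1}_{X_i>0})\geq s,\qquad i=1,\dots,n,$$ and any $0\leq u\leq A'\sqrt{n}$, $$P_u(\tau>n)\geq\frac{c(u+1)}{\sqrt{n}}.$$
   Context: Under $P_u$ the walk is $S_0=u$, $S_k=u+X_1+\dots+X_k$, and $\tau=\min\{k\geq 1: S_k<0\}$ (so $\{\tau>n\}=\{S_k\geq 0,\ k=1,\dots,n\}$). *)

(* Defs.v *)
From HB Require Import structures.
From mathcomp Require Export all_boot all_order all_algebra.
From mathcomp Require Export all_classical all_reals all_analysis.

Set Implicit Arguments.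
Unset Strict Implicit.
Unset Printing Implicit Defensive.

Import Order.TTheory GRing.Theory Num.Theory.
Import numFieldNormedType.Exports.

Local Open Scope classical_set_scope.
Local Open Scope ring_scope.

Definition mutual_independence (R : realType) (d : measure_display)
    (T : measurableType d) (P : probability T R) (I : finType)
    (X : I -> {RV P >-> R}) : Prop :=
  forall (J : {set I}) (B : I -> set R),
    (forall i, i \in J -> measurable (B i)) ->
    P (\bigcap_(i in [set` J]) (X i @^-1` B i)) =
    (\prod_(i in J) P (X i @^-1` B i))%E.

Arguments mutual_independence {R d T} P {I} X.

Section walk.
Context (R : realType) (T : Type) (n : nat).
Implicit Types (X : 'I_n -> T -> R) (u : R) (k : nat) (w : T).

(* The index [i : 'I_n] stands for the (i+1)-st step, so [walk u X k] is
   u + X_1 + ... + X_k for k <= n. *)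
Definition walk u X k w : R := u + \sum_(i < n | (i < k)%N) X i w.

(* Extended-real valued, +oo when none of S_1, ..., S_n is negative:
   only n steps are given, so later exits are not seen. *)
Definition exit_time u X w : \bar R :=
  ereal_inf [set k%:R%:E | k in [set k | (1 <= k <= n)%N /\ walk u X k w < 0]].

Lemma exit_time_gtE u X :
  [set w | n%:R%:E < exit_time u X w]%E =
  [set w | forall k, (1 <= k <= n)%N -> 0 <= walk u X k w].
Proof.
apply/seteqP; split => w /=.
- move=> ltn k kn; rewrite leNgt; apply/negP => Sk.
  have : (exit_time u X w <= k%:R%:E)%E by apply: ereal_inf_lbound; exists k.
  move=> /(lt_le_trans ltn); rewrite lte_fin ltr_nat ltnNge.
  by case/andP: kn => _ ->.
- move=> S0; rewrite /exit_time.
  rewrite (_ : [set k | _ /\ _] = set0) ?image_set0 ?ereal_inf0 ?ltry//.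
  by rewrite -subset0 => k /= [/S0]; rewrite leNgt => /negP.
Qed.

End walk.

(* Main.v *)
Require Import Defs.
From mathcomp Require Import ring lra measurable_realfun.
Import Order.TTheory GRing.Theory Num.Theory.
Import numFieldNormedType.Exports.
Local Open Scope classical_set_scope.
Local Open Scope ring_scope.

(** The proof is a potential-function argument.  For a Brownian motion started
at z and killed below 0, the probability of surviving for a time t is of order
z / sqrt t as long as z is at most of order sqrt t.  A polynomial with this
behaviour is suggested by the heat equation: h z - h^3 (z^3 + 3 v z) is turned
into h z - h^3 z^3 in the mean when v is the variance still to be collected.
Take h = 1 / (K sqrt n) with a large constant K, and let m be the number of steps
to go.  The function
  potential h M m z = max (0, (h - 3 M m h^3) z^+ - h^3 (z^+)^3 - M m h^3)
has three properties:
- at m = 0 it lies below the indicator of z >= 0, as t - t^3 <= 1 for t >= 0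
  ([potential_le1]);
- it is a submartingale along the walk stopped at its first negative value:
  E (potential m (z + X)) >= potential (m+1) z for z >= 0.  The term 3 M m h^3
  pays for the variance, and the term M m h^3 for the third moment of the step,
  which has no sign ([potential_step]);
- after one step from u it is already at least of order h (u + 1), even for
  u = 0.  This is where a lower bound for E X^+ enters: E (u + X)^+ is at least
  u because X is centred, and at least s, so at least (u + s) / 2
  ([potential_first_step]).

The walk survives n steps exactly when the stopped walk is nonnegative at
time n, so the chain
  P (tau > n) >= E (potential 0 Z_n) >= ... >= E (potential (n-1) Z_1)
gives the theorem ([survival_ge]).  All errors relative to the main term h u or
h s are of order 1 / K^2, uniformly in n and in u <= A' sqrt n, because
h^2 n = 1 / K^2 ([survival_constant]).  Since y^2 and |y|^3 are both at most
1 + y^4, M = 1 + A bounds the second and the third absolute moment of the steps.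

Every inequality between expectations in the chain integrates a one-step bound
over the past.  The stopped walk Z_k is measurable for the sigma-algebra
generated by the first k steps, hence independent of the next one
([cylinders_independent]), and Tonelli's theorem then allows the past to be
treated as a constant ([freezing]).  Nonnegativity of the potential makes this
possible without any integrability of the walk itself. *)

(** * The potential *)

(** Positive parts are needed because - z^3 would reward large negative values. *)
Definition potential {R : realType} (h M : R) (m : nat) (z : R) : R :=
  Num.max 0 ((h - 3 * M * m%:R * h ^+ 3) * Num.max z 0
             - h ^+ 3 * Num.max z 0 ^+ 3 - M * m%:R * h ^+ 3).

Section potential.
Context {R : realType}.
Implicit Types (h M z y a : R).

(** For z + y >= 0 this is the binomial expansion with y^2 and y^3 replaced by
1 + y^4.  For z + y < 0 the expansion with |y|^3 in place of y^3 is still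
nonnegative, since |y| > z there.  Only y and y^4 remain on the right, the two
powers whose means are controlled. *)
Lemma cube_pos_le z y : 0 <= z ->
  Num.max (z + y) 0 ^+ 3 <= z ^+ 3 + 3 * z ^+ 2 * y + (3 * z + 1) * (1 + y ^+ 4).
Proof.
move=> z0.
have y2 : y ^+ 2 <= 1 + y ^+ 4.
  have := sqr_ge0 (y ^+ 2 - 1); rewrite -subr_ge0 => ?.
  have := sqr_ge0 (y ^+ 2); nra.
have hz : 3 * z * y ^+ 2 <= 3 * z * (1 + y ^+ 4) by apply: ler_wpM2l => //; nra.
have y3 : `|y| ^+ 3 <= 1 + y ^+ 4.
  have -> : y ^+ 4 = `|y| ^+ 4 by rewrite -normrX ger0_norm// (exprM _ 2 2) sqr_ge0.
  move: `|y| (normr_ge0 y) => t t0.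
  have := sqr_ge0 (t ^+ 2 - t); have := sqr_ge0 t.
  have [t1|t1] := leP t 1; last first.
    suff : 0 <= t^+3 * (t-1) by nra.
    by apply: mulr_ge0; [exact: exprn_ge0|rewrite subr_ge0 ltW].
  have : t ^+ 3 <= 1 by exact: exprn_ile1.
  have : 0 <= t ^+ 4 by exact: exprn_ge0.
  lra.
suff : Num.max (z + y) 0 ^+ 3 <= z ^+ 3 + 3 * z ^+ 2 * y + 3 * z * y ^+ 2 + `|y| ^+ 3 by lra.
have [zy|zy] := leP 0 (z + y).
  have : y ^+ 3 <= `|y| ^+ 3 by rewrite -normrX ler_norm.
  have -> : (z + y) ^+ 3 = z ^+ 3 + 3 * z ^+ 2 * y + 3 * z * y ^+ 2 + y ^+ 3 by ring.
  lra.
rewrite expr0n/= ltr0_norm; last lra.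
set t := - y; have -> : y = - t by rewrite /t; lra.
(* now z + y = z - t < 0, and the left-hand side is 0 *)
have zt : z < t by rewrite /t; lra.
have -> : z ^+ 3 + 3 * z ^+ 2 * - t + 3 * z * (- t) ^+ 2 + t ^+ 3 = 2 * t ^+ 3 - (t - z) ^+ 3 by ring.
have : (t - z) ^+ 3 <= t ^+ 3 by rewrite lerXn2r ?nnegrE; lra.
have : 0 <= t ^+ 3 by apply: exprn_ge0; lra.
lra.
Qed.

Lemma potential_ge0 h M m z : 0 <= potential h M m z.
Proof. by rewrite le_max lexx. Qed.

Lemma potential_le1 h M m z : 0 <= h -> 0 <= M -> potential h M m z <= (0 <= z)%R%:R.
Proof.
move=> h0 M0; rewrite ge_max ler0n /=.
have Mm : 0 <= M * m%:R * h ^+ 3 by rewrite !mulr_ge0// exprn_ge0.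
have [z0|z0] := leP 0 z; last by rewrite mulr0 expr0n/= mulr0 mulr0n; lra.
rewrite mulr1n.
have hz : 0 <= h * z by exact: mulr_ge0.
have : h * z - (h * z) ^+ 3 <= 1.
  have [t1|t1] := leP (h * z) 1; first by have := exprn_ge0 3 hz; lra.
  have : h * z <= (h * z) ^+ 3 by rewrite -[X in X <= _]expr1 ler_eXn2l.
  lra.
have := mulr_ge0 Mm z0.
rewrite exprMn; lra.
Qed.

(** The free t allows two uses: t = z + y for the submartingale property, and
a mean of two lower bounds of (z + y)^+ for the first step. *)
Lemma potential_ge h M m z y : 0 <= h -> 0 <= z ->
  0 <= h - 3 * M * m%:R * h ^+ 3 -> forall t, t <= Num.max (z + y) 0 ->
  (h - 3 * M * m%:R * h ^+ 3) * t
   - h ^+ 3 * (z ^+ 3 + 3 * z ^+ 2 * y + (3 * z + 1) * (1 + y ^+ 4))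
   - M * m%:R * h ^+ 3 <= potential h M m (z + y).
Proof.
move=> h0 z0 a0 t tzy.
rewrite le_max; apply/orP; right.
rewrite lerD2r lerB// ler_wpM2l// ?exprn_ge0//.
exact: cube_pos_le.
Qed.

Lemma measurable_potential h M m : measurable_fun setT (potential h M m).
Proof.
apply: measurable_maxr; first exact: measurable_cst.
have mp : measurable_fun setT (fun z : R => Num.max z 0).
  by apply: measurable_maxr; [exact: measurable_id|exact: measurable_cst].
apply: measurable_funB; last exact: measurable_cst.
apply: measurable_funB; apply: measurable_funM; do ?exact: measurable_cst => //.
  exact: mp.
exact: (measurableT_comp (exprn_measurable 3) mp).
Qed.

End potential.

(** * Expectations from the three moment conditions *)

Section expectation_bound.
Context d (T : measurableType d) (R : realType) (P : probability T R).
Variable (X : {RV P >-> R}).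
Local Open Scope ereal_scope.

(** The mean of a minorant of g built from X, X^4 and X^+ only depends on what is
known about X; the signs of ga and de match the directions of the two moment
inequalities. *)
Lemma expectation_quartic_lower_bound (A s : R) (g : R -> R) (al be ga de : R) :
  'E_P[X] = 0 -> 'E_P[fun w => (X w ^+ 4)%R] <= A%:E ->
  s%:E <= 'E_P[fun w => (X w * \1_[set x | (0 < x)%R] (X w))%R] ->
  measurable_fun setT g -> (forall y, (0 <= g y <= 1)%R) ->
  (0 <= ga)%R -> (0 <= de)%R ->
  (forall y, (al + be * y - ga * y ^+ 4
              + de * (y * \1_[set x | (0 < x)%R] y) <= g y)%R) ->
  (al - ga * A + de * s)%:E <= 'E_P[g \o X].
Proof.
set pos := fun y : R => (y * \1_[set x | (0 < x)%R] y)%R.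
move=> EX EX4 EXp mg g01 ga0 de0 lb.
have mX : measurable_fun setT X by [].
have mX4 : measurable_fun setT (fun w => X w ^+ 4)%R.
  exact: (measurableT_comp (exprn_measurable 4) mX).
have iX4 : P.-integrable setT (EFin \o (fun w => X w ^+ 4)%R).
  apply/integrableP; split; first exact/measurable_EFinP.
  rewrite (eq_integral (fun w => (X w ^+ 4)%:E)).
    by apply: (le_lt_trans _ (ltry A)); rewrite unlock in EX4.
  by move=> w _ /=; rewrite ger0_norm// (exprM _ 2 2) sqr_ge0.
(* 1 + X^4 dominates X, its positive part and g at once *)
have i1 : P.-integrable setT (EFin \o (fun w => 1 + X w ^+ 4)%R).
  have -> : EFin \o (fun w => 1 + X w ^+ 4)%R = cst 1 \+ EFin \o (fun w => X w ^+ 4)%R by [].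
  apply: integrableD => //.
  exact: finite_measure_integrable_cst.
have ytail (y : R) : (`|y| <= 1 + y ^+ 4)%R.
  have -> : (y ^+ 4 = `|y| ^+ 4)%R by rewrite -normrX ger0_norm// (exprM _ 2 2) sqr_ge0.
  move: `|y|%R (normr_ge0 y) => t t0.
  have [t1|t1] := leP t 1%R; first by have := exprn_ge0 4 t0; lra.
  have : (t <= t ^+ 4)%R by rewrite -[leLHS]expr1 ler_eXn2l.
  lra.
have iX : P.-integrable setT (EFin \o X).
  apply: (le_integrable _ _ _ i1) => //; first exact/measurable_EFinP.
  move=> w _ /=; rewrite lee_fin (le_trans (ytail _))// ler_norm//.
have mpos : measurable_fun setT (pos \o X).
  apply: measurable_funM => //; apply: measurableT_comp => //.
  apply: measurable_indic.
  rewrite (_ : [set x | (0 < x)%R] = `]0%R, +oo[%classic) //.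
  by apply/seteqP; split => x /=; rewrite in_itv/= andbT.
have ip : P.-integrable setT (EFin \o (pos \o X)).
  apply: (le_integrable _ _ _ i1) => //; first exact/measurable_EFinP.
  move=> w _ /=; rewrite lee_fin (le_trans _ (ler_norm _))// (le_trans _ (ytail _))//.
  by rewrite /pos normrM ler_piMr// indicE; case: (_ \in _); rewrite ?normr1// normr0.
have ig : P.-integrable setT (EFin \o (g \o X)).
  apply: (le_integrable _ _ _ i1) => //; first exact/measurable_EFinP/measurableT_comp.
  move=> w _ /=; rewrite lee_fin (le_trans _ (ler_norm _))//.
  have /andP[g0 g1] := g01 (X w).
  rewrite ger0_norm// (le_trans g1)// lerDl (exprM _ 2 2) sqr_ge0//.
have i0 (r : R) : P.-integrable setT (EFin \o (fun=> r)).
  exact: finite_measure_integrable_cst.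
have iZ (r : R) (f : T -> R) : P.-integrable setT (EFin \o f) ->
   P.-integrable setT (EFin \o (fun w => r * f w)%R).
  by move=> iF; exact: (integrableZl measurableT r iF).
have iD (f f' : T -> R) : P.-integrable setT (EFin \o f) ->
   P.-integrable setT (EFin \o f') -> P.-integrable setT (EFin \o (fun w => f w + f' w)%R).
  by move=> iF iF'; exact: (integrableD measurableT iF iF').
have EE (f : T -> R) : P.-integrable setT (EFin \o f) ->
    'E_P[f] = (\int[P]_w f w)%R%:E.
  by move=> iF; rewrite unlock fineK//; exact: integrable_fin_num.
rewrite (EE X)// in EX; case: EX => EX.
rewrite (EE _ iX4) lee_fin in EX4.
rewrite (EE _ ip) lee_fin in EXp.
rewrite (EE _ ig) lee_fin.
apply: (@le_trans _ _ (\int[P]_w (al + be * X w + (- ga) * X w ^+ 4 + de * (pos \o X) w))%R).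
  rewrite !RintegralD// ?RintegralZl//; do ?[exact: iD|exact: iZ].
  - rewrite EX mulr0 addr0 Rintegral_cst// (_ : fine (P setT) = 1%R) ?probability_setT// mulr1.
    by rewrite lerD// ?ler_wpM2l// lerD2l mulNr lerN2 ler_wpM2l.
  - by apply: (iD) => //; exact: iZ.
  - apply: (iD); last exact: iZ.
    by apply: (iD) => //; exact: iZ.
apply: le_Rintegral => //.
  apply: (iD); last exact: iZ.
  apply: (iD); last exact: iZ.
  by apply: (iD) => //; exact: iZ.
by move=> w _; rewrite /= mulNr; exact: lb.
Qed.
End expectation_bound.

(** * Independence of the next step from the past *)

Definition independent_pair {R : realType} {d} {T : measurableType d}
    (P : probability T R) (Z Y : T -> R) :=
  forall A B : set R, measurable A -> measurable B ->
    P (Z @^-1` A `&` Y @^-1` B) = (P (Z @^-1` A) * P (Y @^-1` B))%E.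

(** A pi-system generating the sigma-algebra of the family (X i) for i in J. *)
Definition cylinders {T U : Type} {I : finType} (mU : set (set U)) (X : I -> T -> U)
    (J : {set I}) : set (set T) :=
  [set D | exists2 B : I -> set U, (forall i, mU (B i)) &
     D = \bigcap_(i in [set` J]) (X i @^-1` B i)].

Section independence.
Context d (T : measurableType d) (R : realType) (P : probability T R).
Context (I : finType) (X : I -> {RV P >-> R}).

Let cyl (J : {set I}) := cylinders (@measurable _ R) X J.

Lemma cylinders_setI_closed J : setI_closed (cyl J).
Proof.
move=> _ _ [B mB ->] [C mC ->].
exists (fun i => B i `&` C i); first by move=> i; exact: measurableI.
rewrite -bigcapI; apply: eq_bigcapr => i _.
by rewrite preimage_setI.
Qed.

Lemma cylinders_measurable J : cyl J `<=` measurable.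
Proof.
move=> _ [B mB ->]; apply: fin_bigcap_measurable => // i _.
exact: measurable_funPTI.
Qed.

(** As functions of D, both sides are finite measures; they agree on the
pi-system of cylinders by the product rule for the family indexed by j |: J,
hence on the sigma-algebra that it generates. *)
Lemma cylinders_independent (J : {set I}) j (D : set T) (B : set R) :
  mutual_independence P X -> j \notin J -> <<s cyl J >> D -> measurable B ->
  P (D `&` X j @^-1` B) = (P D * P (X j @^-1` B))%E.
Proof.
move=> indX jJ JD mB.
have mXB : measurable (X j @^-1` B) by exact: measurable_funPTI.
have PXB : (P (X j @^-1` B) \is a fin_num)%E by exact: fin_num_measure.
pose r : {nonneg R} := NngNum (fine_ge0 (measure_ge0 P (X j @^-1` B))).
transitivity (mrestr P mXB D); first by [].
transitivity (mscale r P D); last by rewrite /mscale/= fineK// muleC.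
have setT_cyl : cyl J setT.
  exists (fun=> setT); first by move=> i; exact: measurableT.
  by rewrite bigcapT.
apply: (g_sigma_algebra_measure_unique (cyl J) (@cylinders_measurable J) (fun=> setT)) => //.
- exact: bigcup_const.
- exact: cylinders_setI_closed.
- move=> _ [C mC ->].
  rewrite /= /mrestr /mscale /= fineK//.
  pose C' i := if i == j then B else C i.
  have C'J i : i \in J -> C' i = C i.
    by rewrite /C'; case: eqP => // -> jJ'; rewrite jJ' in jJ.
  have mC' i : measurable (C' i) by rewrite /C'; case: ifP.
  have C'j : C' j = B by rewrite /C' eqxx.
  have : P (\bigcap_(i in [set` j |: J]) X i @^-1` C' i) =
      (P (X j @^-1` B) * \prod_(i in J) P (X i @^-1` C' i))%E.
    by rewrite indX// big_setU1//= C'j.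
  rewrite -indX// => PC'.
  rewrite (_ : _ `&` _ = \bigcap_(i in [set` j |: J]) X i @^-1` C' i).
    rewrite PC'; congr (_ * P _)%E.
    by apply: eq_bigcapr => i iJ; rewrite C'J.
  apply/seteqP; split => [w [Cw Bw] i /=|w C'w].
    by rewrite in_setU1 => /predU1P[->|iJ]; [rewrite C'j|rewrite C'J//; exact: Cw].
  split => [i iJ|]; last by rewrite -C'j; apply: C'w; rewrite /= setU11.
  by rewrite -C'J//; apply: C'w; rewrite /= setU1r.
- by move=> _; rewrite /= /mrestr setTI ltey_eq PXB.
Qed.

Lemma measurable_cylinders_independent (J : {set I}) j (Z : T -> R) :
  mutual_independence P X -> j \notin J ->
  measurable_fun (T := g_sigma_algebraType (cyl J)) setT Z -> independent_pair P Z (X j).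
Proof.
move=> indX jJ mZ A B mA mB; apply: (@cylinders_independent J) => //.
by rewrite -[X in <<s _ >> X]setTI; exact: mZ.
Qed.

Lemma cylinders_measurable_fun (J : {set I}) i : i \in J ->
  measurable_fun (T := g_sigma_algebraType (cyl J)) setT (X i).
Proof.
move=> iJ _ A mA; rewrite setTI; apply: sub_sigma_algebra.
exists (fun k => if k == i then A else setT).
  by move=> k; case: ifP.
apply/seteqP; split => [w Aw k _ /=|w /(_ i iJ)/=]; last by rewrite eqxx.
by case: eqP => // ->.
Qed.
End independence.

(** * The walk stopped at its first negative value *)

(** Stopping keeps the survival event in the value of the walk: a real-valued
Markov chain replaces the walk together with its exit time. *)
Fixpoint stopped_walk {R : realType} {T : Type} (u : R) (X : nat -> T -> R)
    (k : nat) (w : T) : R :=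
  if k is k'.+1 then
    let z := stopped_walk u X k' w in if 0 <= z then z + X k' w else z
  else u.

Section stopped.
Context (R : realType).

Lemma stopped_walk_sum T (u : R) (X : nat -> T -> R) k w :
  0 <= stopped_walk u X k w -> stopped_walk u X k w = u + \sum_(i < k) X i w.
Proof.
elim: k => [|k IH] /=; first by rewrite big_ord0 addr0.
case: ifPn => [z0 _|/negP//].
by rewrite (IH z0) big_ord_recr addrA.
Qed.

Lemma stopped_walk_ge0 T (u : R) (X : nat -> T -> R) n w : 0 <= u ->
  0 <= stopped_walk u X n w <->
  forall k, (1 <= k <= n)%N -> 0 <= u + \sum_(i < k) X i w.
Proof.
move=> u0; elim: n => [|n [IH1 IH2]] /=; first by split => // _ [].
case: ifPn => z0; last first.
  split => [/(negP z0)//|H]; exfalso; apply: (negP z0); apply: IH2 => k /andP[k1 kn].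
  by apply: H; rewrite k1 ltnW.
rewrite (stopped_walk_sum _ _ _ _ _ z0) -addrA -(big_ord_recr n (fun i => X i w)).
split => [h k /andP[k1]|]; last by apply; rewrite ltnSn.
rewrite leq_eqVlt => /orP[/eqP ->//|kn].
by apply: IH1 => //; rewrite k1.
Qed.

Lemma measurable_stopped_walk d (T : measurableType d) (u : R) (X : nat -> T -> R) n :
  (forall i, (i < n)%N -> measurable_fun setT (X i)) ->
  measurable_fun setT (stopped_walk u X n).
Proof.
elim: n => [|n IH] mX /=; first exact: measurable_cst.
have mz : measurable_fun setT (stopped_walk u X n) by apply: IH => i /ltnW; exact: mX.
apply: measurable_fun_ifT => //.
  by apply: measurable_fun_ler => //; exact: measurable_cst.
by apply: measurable_funD => //; exact: mX.
Qed.
End stopped.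

(** * The submartingale property *)

Section freezing.
Context d (T : measurableType d) (R : realType) (P : probability T R).
Local Open Scope ereal_scope.

(** Under independence the joint law of (Z, Y) is the product of the two laws, and
Tonelli's theorem integrates over Y first, with Z held fixed. *)
Lemma freezing (Z Y : {RV P >-> R}) (f : R * R -> R) (g : R -> R) :
  independent_pair P Z Y ->
  measurable_fun setT f -> measurable_fun setT g ->
  (forall x, (0 <= f x)%R) -> (forall z, (0 <= g z)%R) ->
  (forall z, (g z)%:E <= 'E_P[fun w => f (z, Y w)]) ->
  'E_P[g \o Z] <= 'E_P[fun w => f (Z w, Y w)].
Proof.
move=> ZY mf mg f0 g0 gf.
have mZ : measurable_fun setT Z by [].
have mY : measurable_fun setT Y by [].
have mZY : measurable_fun setT (fun w => (Z w, Y w)) by exact: measurable_fun_pair.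
pose push : {measure set (R * R) -> \bar R} :=
  pushforward P (fun w => (Z w, Y w)).
pose joint := push mZY.
pose lZ : probability _ _ := distribution P Z.
pose lY : probability _ _ := distribution P Y.
have jE S : measurable S -> (lZ \x lY) S = joint S.
  by move=> mS; apply: product_measure_unique.
rewrite unlock.
have mEf : measurable_fun setT (EFin \o f) by exact/measurable_EFinP.
have -> : \int[P]_w (f (Z w, Y w))%:E = \int[joint]_x (f x)%:E.
  by rewrite ge0_integral_pushforward// => x _; rewrite lee_fin.
have -> : \int[joint]_x (f x)%:E = \int[lZ \x lY]_x (f x)%:E.
  by apply: eq_measure_integral => S mS _; exact/esym/jE.
rewrite (fubini_tonelli1 (EFin \o f))//.
have -> : \int[P]_w ((g \o Z) w)%:E = \int[lZ]_z (g z)%:E.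
  rewrite ge0_integral_distribution//; exact/measurable_EFinP.
apply: ge0_le_integral => //.
- by move=> z _; rewrite lee_fin.
- exact/measurable_EFinP.
- by apply: measurable_fun_fubini_tonelli_F => // x; rewrite lee_fin.
move=> z _; apply: (le_trans (gf z)).
rewrite unlock /fubini_F ge0_integral_distribution//.
  by apply: measurableT_comp => //.
by move=> x; rewrite lee_fin.
Qed.

End freezing.

Section one_step.
Context d (T : measurableType d) (R : realType) (P : probability T R).
Variables (Y : {RV P >-> R}) (A s h : R) (m : nat).
Let M := 1 + A.
Hypotheses (A0 : 0 <= A) (h0 : 0 <= h) (a0 : 0 <= h - 3 * M * m%:R * h ^+ 3).
Hypothesis EY : ('E_P[Y] = 0)%E.
Hypothesis EY4 : ('E_P[fun w => (Y w ^+ 4)%R] <= A%:E)%E.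
Hypothesis EYp : (s%:E <= 'E_P[fun w => (Y w * \1_[set x | (0 < x)%R] (Y w))%R])%E.

Let M0 : 0 <= M. Proof. exact: addr_ge0. Qed.

Lemma expectation_potential_ge (z al ga de : R) :
  0 <= z -> 0 <= ga -> 0 <= de ->
  (exists be, forall y, al + be * y - ga * y ^+ 4
     + de * (y * \1_[set x | (0 < x)%R] y) <= potential h M m (z + y)) ->
  ((al - ga * A + de * s)%:E <= 'E_P[fun w => potential h M m (z + Y w)%R])%E.
Proof.
move=> z0 ga0 de0 [be lb].
apply: (expectation_quartic_lower_bound _ _ _ _ _ _ _ (fun y => potential h M m (z + y))) lb => //.
  apply: (measurableT_comp (measurable_potential h M m)).
  by apply: measurable_funD; [exact: measurable_cst|exact: measurable_id].
move=> y; rewrite potential_ge0 (le_trans (potential_le1 _ _ _ _ h0 M0))//.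
by case: (0 <= z + y); rewrite ?lexx ?ler01.
Qed.

(** The lower bound of [potential_ge] at t = z + y is affine in y and y^4, and its
mean is at least the expression under the maximum in [potential h M m.+1 z].  A
walk that is already negative does not move, and its potential is 0. *)
Lemma potential_step (z : R) :
  ((potential h M m.+1 z)%:E <=
   'E_P[fun w => potential h M m (if 0 <= z then z + Y w else z)%R])%E.
Proof.
have E0 : (0 <= 'E_P[fun w => potential h M m (if 0 <= z then z + Y w else z)%R])%E.
  by apply: expectation_ge0 => w; exact: potential_ge0.
move: E0; case: (boolP (0 <= z)) => z0 E0; last first.
  apply: le_trans E0; rewrite lee_fin.
  by apply: (le_trans (potential_le1 _ _ _ _ h0 M0)); rewrite (negbTE z0).
rewrite [in X in (X%:E <= _)%E]/potential (_ : Num.max z 0 = z); last exact/max_idPl.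
rewrite EFin_max ge_max E0 /=.
pose a := h - 3 * M * m%:R * h ^+ 3.
pose al := a * z - h ^+ 3 * (z ^+ 3 + 3 * z + 1) - M * m%:R * h ^+ 3.
pose ga := h ^+ 3 * (3 * z + 1).
rewrite [X in (X%:E <= _)%E](_ : _ = al - ga * A + 0 * s); last first.
  by rewrite /al /ga /a /M -addn1 natrD; ring.
have h3 : 0 <= h ^+ 3 by exact: exprn_ge0.
apply: expectation_potential_ge => //; first by apply: mulr_ge0 => //; lra.
exists (a - 3 * z ^+ 2 * h ^+ 3) => y.
apply: le_trans (potential_ge _ _ _ _ _ h0 z0 a0 (z + y) _); last by rewrite le_max lexx.
by rewrite le_eqVlt; apply/orP; left; apply/eqP; rewrite /al /ga /a; ring.
Qed.

(** Here t is the mean of u + y and y^+, two lower bounds of (u + y)^+; its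
expectation is at least (u + s) / 2, which stays positive at u = 0. *)
Lemma potential_first_step (u : R) : 0 <= u ->
  ((  (h - 3 * M * m%:R * h ^+ 3) * ((u + s) / 2)
    - h ^+ 3 * (u ^+ 3 + 3 * M * u) - M * m.+1%:R * h ^+ 3)%:E <=
   'E_P[fun w => potential h M m (u + Y w)%R])%E.
Proof.
move=> u0.
pose a := h - 3 * M * m%:R * h ^+ 3.
pose al := a * (u / 2) - h ^+ 3 * (u ^+ 3 + 3 * u + 1) - M * m%:R * h ^+ 3.
pose ga := h ^+ 3 * (3 * u + 1).
rewrite [X in (X%:E <= _)%E](_ : _ = al - ga * A + a / 2 * s); last first.
  by rewrite /al /ga /a /M -addn1 natrD; field.
have h3 : 0 <= h ^+ 3 by exact: exprn_ge0.
apply: expectation_potential_ge => //; first by apply: mulr_ge0 => //; lra.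
  by apply: mulr_ge0 => //; lra.
exists (a / 2 - 3 * u ^+ 2 * h ^+ 3) => y.
apply: le_trans (potential_ge _ _ _ _ _ h0 u0 a0
  ((u + y + y * \1_[set x | 0 < x] y) / 2) _); last first.
  rewrite indicE; case: (boolP (y \in _)); rewrite ?inE /= ?notin_setE /= => y0.
    by rewrite le_max; apply/orP; left; lra.
  by move/negP: y0; rewrite -leNgt => y0; case: (leP 0 (u + y)) => ?; lra.
by rewrite le_eqVlt; apply/orP; left; apply/eqP; rewrite /al /ga /a; field.
Qed.

End one_step.

(** * The survival probability *)

Section walk.
Context d (T : measurableType d) (R : realType) (P : probability T R).
Context (n : nat) (X : 'I_n.+1 -> {RV P >-> R}).
(* indices beyond n are never reached, so the default of inord is harmless *)
Let Xn (i : nat) : {RV P >-> R} := X (inord i).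
Hypothesis indX : mutual_independence P X.

Lemma survivalE (u : R) : 0 <= u ->
  [set w | n.+1%:R%:E < exit_time u X w]%E =
  [set w | 0 <= stopped_walk u Xn n.+1 w].
Proof.
move=> u0; rewrite exit_time_gtE; apply/seteqP.
have E k w : (k <= n.+1)%N -> walk u X k w = u + \sum_(i < k) Xn i w.
  move=> kn; rewrite /walk (big_ord_widen n.+1 (fun i => Xn i w))//.
  by congr (_ + _); apply: eq_bigr => i _; rewrite /Xn inord_val.
split => w /= H.
  apply: (stopped_walk_ge0 _ _ u Xn n.+1 w u0).2 => k k1n.
  by rewrite -E; [exact: H|case/andP: k1n].
move=> k kn; rewrite E; last by case/andP: kn.
exact: (stopped_walk_ge0 _ _ u Xn n.+1 w u0).1.
Qed.

Lemma stopped_walk_indep (u : R) k : (k <= n)%N ->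
  independent_pair P (stopped_walk u Xn k) (Xn k).
Proof.
move=> kn; apply: (@measurable_cylinders_independent _ _ _ _ _ _
  [set i : 'I_n.+1 | (i < k)%N]) => //.
  by rewrite inE inordK// ltnn.
apply: measurable_stopped_walk => i ik.
by apply: cylinders_measurable_fun; rewrite inE inordK// ltnS (leq_trans (ltnW ik)).
Qed.

Variables (A s h : R).
Let M := 1 + A.
Hypotheses (A0 : 0 <= A) (h0 : 0 <= h) (a0 : 0 <= h - 3 * M * n%:R * h ^+ 3).
Hypothesis EX : (forall i, 'E_P[X i] = 0)%E.
Hypothesis EX4 : (forall i, 'E_P[fun w => (X i w ^+ 4)%R] <= A%:E)%E.
Hypothesis EXp : (forall i,
  s%:E <= 'E_P[fun w => (X i w * \1_[set x | (0 < x)%R] (X i w))%R])%E.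

Lemma survival_ge (u : R) : 0 <= u ->
  ((  (h - 3 * M * n%:R * h ^+ 3) * ((u + s) / 2)
    - h ^+ 3 * (u ^+ 3 + 3 * M * u) - M * n.+1%:R * h ^+ 3)%:E <=
   P [set w | (n.+1%:R%:E < exit_time u X w)%E])%E.
Proof.
move=> u0; rewrite survivalE//.
have M0 : 0 <= M by exact: addr_ge0.
have h3 : 0 <= h ^+ 3 by exact: exprn_ge0.
have mS k : measurable_fun setT (stopped_walk u Xn k).
  by apply: measurable_stopped_walk => i _; exact: measurable_funP.
have am m : (m <= n)%N -> 0 <= h - 3 * M * m%:R * h ^+ 3.
  move=> mn; apply: le_trans a0 _; rewrite lerB// ler_wpM2r// ler_wpM2l ?ler_nat//.
  by rewrite mulr_ge0.
(* the submartingale chain, from time 1 to time k+1 with m = n - k steps to go *)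
have main k m : (k + m)%N = n ->
  ((  (h - 3 * M * n%:R * h ^+ 3) * ((u + s) / 2)
    - h ^+ 3 * (u ^+ 3 + 3 * M * u) - M * n.+1%:R * h ^+ 3)%:E <=
   'E_P[potential h M m \o stopped_walk u Xn k.+1])%E.
  elim: k m => [|k IH] m.
    rewrite add0n => ->.
    have -> : potential h M n \o stopped_walk u Xn 1 =
        (fun w => potential h M n (u + Xn 0 w)).
      by apply/funext => w; rewrite /= u0.
    exact: (potential_first_step _ _ _ P (Xn 0) A s h n A0 h0 a0
      (EX _) (EX4 _) (EXp _)).
  move=> km; apply: (le_trans (IH m.+1 _)); first by rewrite addnS -addSn.
  pose Z : {RV P >-> R} := mfun_Sub (mem_set (mS k.+1)).
  apply: (freezing _ _ _ P Z (Xn k.+1) (fun zy : R * R =>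
    potential h M m (if 0 <= zy.1 then zy.1 + zy.2 else zy.1))
    (potential h M m.+1)) => //.
  - by apply: stopped_walk_indep; rewrite -km leq_addr.
  - apply: (measurableT_comp (measurable_potential h M m)).
    apply: measurable_fun_ifT.
    + by apply: measurable_fun_ler => //; exact: measurable_cst.
    + exact: measurable_funD.
    + exact: measurable_fst.
  - exact: measurable_potential.
  - by move=> ?; exact: potential_ge0.
  - by move=> ?; exact: potential_ge0.
  - have mn : (m <= n)%N by rewrite -km leq_addl.
    exact: (potential_step _ _ _ P (Xn k.+1) A s h m A0 h0 (am m mn)
      (EX _) (EX4 _) (EXp _)).
apply: (le_trans (main n 0%N _)); first by rewrite addn0.
have mA : measurable [set w | 0 <= stopped_walk u Xn n.+1 w].
  rewrite (_ : [set w | _] = stopped_walk u Xn n.+1 @^-1` `[0, +oo[%classic).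
    by rewrite -[X in measurable X]setTI; exact: mS.
  by apply/seteqP; split => w /=; rewrite in_itv/= andbT.
rewrite -[X in P X]setIT -integral_indic// unlock; apply: ge0_le_integral => //.
- by move=> w _; rewrite lee_fin potential_ge0.
- by apply/measurable_EFinP/measurableT_comp => //; exact: measurable_potential.
- by apply/measurable_EFinP; exact: measurable_indic.
move=> w _; rewrite lee_fin indicE (le_trans (potential_le1 _ _ _ _ h0 M0))//.
by rewrite mem_setE.
Qed.
End walk.

(** * Choice of the constants *)

(** With x = sqrt n and h = 1 / (K x), dividing by h leaves a main term
(u + s) / 2 and errors carrying a factor h^2 x^2 = 1 / K^2 <= 1 / K: a
proportion 3 M / K of the main term, (A'^2 + 3 M) u / K and M / K, where
M = 1 + A.  The last two are at most u / 8 and s / 8 by the second and third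
summands of K; the summand 1 gives 1 / K^2 <= 1 / K.  The number mu stands for the
n - 1 steps left after the first. *)
Lemma survival_constant {R : realType} (A A' s K x u h mu : R) :
  0 <= A -> 0 < s ->
  K = 1 + 8 * (A' ^+ 2 + 3 * (1 + A)) + 8 * (1 + A) / s ->
  1 <= x -> 0 <= mu <= x ^+ 2 ->
  0 <= u <= A' * x -> h = (K * x)^-1 ->
  0 <= h - 3 * (1 + A) * mu * h ^+ 3 /\
  Num.min 1 s / (8 * K) * (u + 1) / x <=
  (h - 3 * (1 + A) * mu * h ^+ 3) * ((u + s) / 2)
    - h ^+ 3 * (u ^+ 3 + 3 * (1 + A) * u) - (1 + A) * x ^+ 2 * h ^+ 3.
Proof.
move=> A0 s0 KE x1 /andP[mu0 mux] /andP[u0 uA] hE.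
set M := 1 + A in KE *.
have M1 : 1 <= M by rewrite lerDl.
have Ms : 0 <= M / s by rewrite divr_ge0//; lra.
have A2 : 0 <= A' ^+ 2 by exact: sqr_ge0.
have K1 : 1 <= K by rewrite KE; lra.
have K0 : 0 < K by lra.
have x0 : 0 < x by lra.
have h0 : 0 < h by rewrite hE invr_gt0 mulr_gt0.
pose e := K^-1.
have e0 : 0 < e by rewrite invr_gt0.
have eK : e * K = 1 by rewrite mulVf// gt_eqF.
have e1 : e <= 1 by rewrite invf_le1.
have hx : h * x = e by rewrite hE invfM -mulrA mulVf ?mulr1// gt_eqF.
have q_x : h ^+ 2 * x ^+ 2 <= e by rewrite -exprMn hx expr2 ler_piMl// ltW.
have q_e : h ^+ 2 <= e.
  by apply: le_trans q_x; rewrite ler_peMr ?sqr_ge0// expr_ge1//; lra.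
have budget : e * (A' ^+ 2 + 3 * M) <= 1 / 8 /\ e * M <= s / 8.
  have eMs : e * (M / s) * s = e * M by field; rewrite gt_eqF.
  have : 0 <= e * (M / s) by rewrite mulr_ge0// ltW.
  have : 0 <= e * (A' ^+ 2 + 3 * M) by rewrite mulr_ge0//; lra.
  have : e + 8 * (e * (A' ^+ 2 + 3 * M)) + 8 * (e * (M / s)) = 1.
    by rewrite -[RHS]eK [in RHS]KE; field; rewrite gt_eqF.
  move=> ? ? ?; split; first lra.
  rewrite -eMs (_ : s / 8 = 1 / 8 * s); last by ring.
  by rewrite ler_wpM2r//; lra.
case: budget => B1 B2.
have qmu : M * (h ^+ 2 * mu) <= M * e.
  rewrite ler_wpM2l//; first lra.
  by apply: le_trans q_x; rewrite ler_wpM2l// sqr_ge0.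
have qx : M * (h ^+ 2 * x ^+ 2) <= M * e by rewrite ler_wpM2l//; lra.
have qu2 : h ^+ 2 * u ^+ 2 <= e * A' ^+ 2.
  apply: (@le_trans _ _ (h ^+ 2 * (A' * x) ^+ 2)).
    by rewrite ler_wpM2l ?sqr_ge0// lerXn2r ?nnegrE//; lra.
  by rewrite exprMn mulrCA mulrC ler_wpM2r.
have cubic : u * (h ^+ 2 * u ^+ 2 + 3 * M * h ^+ 2) <= u * (1 / 8).
  rewrite ler_wpM2l//.
  have : M * h ^+ 2 <= M * e by rewrite ler_wpM2l//; lra.
  lra.
have eA : 0 <= e * A' ^+ 2 by rewrite mulr_ge0// ltW.
have a1 : 7 / 8 <= 1 - 3 * M * mu * h ^+ 2 by lra.
split.
  have -> : h - 3 * M * mu * h ^+ 3 = h * (1 - 3 * M * mu * h ^+ 2) by ring.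
  by rewrite mulr_ge0//; lra.
have -> : Num.min 1 s / (8 * K) * (u + 1) / x = h * (Num.min 1 s * (u + 1) / 8).
  by rewrite hE; field; rewrite !gt_eqF.
have -> : (h - 3 * M * mu * h ^+ 3) * ((u + s) / 2)
    - h ^+ 3 * (u ^+ 3 + 3 * M * u) - M * x ^+ 2 * h ^+ 3 =
  h * ((1 - 3 * M * mu * h ^+ 2) * ((u + s) / 2)
       - u * (h ^+ 2 * u ^+ 2 + 3 * M * h ^+ 2) - M * (h ^+ 2 * x ^+ 2)) by field.
rewrite ler_wpM2l//; first exact: ltW.
have mu1 : Num.min 1 s * (u + 1) <= u + s.
  rewrite mulrDr mulr1 lerD//; last by rewrite ge_min lexx orbT.
  by rewrite ler_piMl// ge_min lexx.
have : 7 / 8 * ((u + s) / 2) <= (1 - 3 * M * mu * h ^+ 2) * ((u + s) / 2).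
  by rewrite ler_wpM2r//; lra.
lra.
Qed.

Theorem lemma3p6 (R : realType) (A A' s : R) :
  0 < A -> 0 < A' -> 0 < s ->
  exists2 c : R, 0 < c &
    forall (n : nat), (1 <= n)%N ->
    forall (d : measure_display) (T : measurableType d) (P : probability T R)
      (X : 'I_n -> {RV P >-> R}),
      mutual_independence P X ->
      (forall i, 'E_P[X i] = 0%:E)%E ->
      (forall i, ('E_P[fun w => (X i w ^+ 4)%R] <= A%:E)%E) ->
      (forall i, (s%:E <= 'E_P[fun w => (X i w * \1_[set x | (0 < x)%R] (X i w))%R])%E) ->
    forall u : R, 0 <= u <= A' * Num.sqrt n%:R ->
      ((c * (u + 1) / Num.sqrt n%:R)%:E
        <= P [set w | (n%:R%:E < exit_time u X w)%E])%E.
Proof.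
move=> A0 A'0 s0.
pose K := 1 + 8 * (A' ^+ 2 + 3 * (1 + A)) + 8 * (1 + A) / s.
have K0 : 0 < K.
  have : 0 < (1 + A) / s by rewrite divr_gt0//; lra.
  by have := sqr_ge0 A'; rewrite /K; lra.
exists (Num.min 1 s / (8 * K)).
  by rewrite divr_gt0 ?mulr_gt0// lt_min ltr01.
case=> // n _ d T P X indX EX EX4 EXp u uA.
have u0 : 0 <= u by case/andP: uA.
set x := Num.sqrt n.+1%:R in uA *.
have x2 : x ^+ 2 = n.+1%:R by rewrite sqr_sqrtr.
have x1 : 1 <= x by rewrite -[leLHS]sqrtr1 ler_wsqrtr// ler1n.
have nx : 0 <= (n%:R : R) <= x ^+ 2 by rewrite x2 ler0n ler_nat /=.
have [a0 cle] := survival_constant A A' s K x u _ _ (ltW A0) s0 erefl x1 nx uA erefl.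
apply: le_trans (survival_ge _ _ _ P n X indX A s _ (ltW A0) _ a0 EX EX4 EXp u u0).
  by rewrite lee_fin -x2.
by rewrite invr_ge0 mulr_ge0//; [exact: ltW|lra].
Qed.
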